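(* Let $f : G \rightarrow H$ be a group homomorphism and let $\mu \in L(G)$. Let $\eta \in L(\mu)$ and let $a_z \in \mu$ be an $L$-point of $\mu$ (with $a\in L$, $z\in G$). Then the $L$-subgroup $f(\eta^{a_z})$ is a conjugate $L$-subgroup of $f(\eta)$ in $f(\mu)$, i.e. it equals $f(\eta)^{b_w}$ for some $L$-point $b_w$ of $f(\mu)$. In fact, $a_{f(z)}$ serves as such an $L$-point: \[ f(\eta^{a_z}) = f(\eta)^{a_{f(z)}}. \]
   Context: $L=\langle L,\le,\vee,\wedge\rangle$ is a completely distributive (complete) lattice with greatest element $1$ and least element $0$. An $L$-subset of a set $X$ is a function $X\to L$; $\eta\subseteq\mu$ means $\eta(x)\le\mu(x)$ for all $x$. For a group $G$, an $L$-subset $\mu$ of $G$ is an $L$-subgroup of $G$ if $\mu(xy)\ge\mu(x)\wedge\mu(y)$ and $\mu(x^{-1})=\mu(x)$ for all $x,y\in G$; $L(G)$ is the set of $L$-subgroups of $G$. For $\mu\in L(G)$, $L(\mu)$ denotes the set of $\eta\in L(G)$ with $\eta\subseteq\mu$ (the $L$-subgroups of $\mu$). For $a\in L$ and $z\in G$, the $L$-point $a_z$ is the $L$-subset with value $a$ at $z$ and $0$ elsewhere; it is an $L$-point of $\mu$ (written $a_z\in\mu$) if $\mu(z)\ge a$. For $\eta\in L(\mu)$ and $a_z\in\mu$, the conjugate of $\eta$ by $a_z$ is the $L$-subgroup $\eta^{a_z}$ of $\mu$ given by $\eta^{a_z}(x)=a\wedge\eta(zxz^{-1})$ for all $x\in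 G$ (and analogously for $H$). For a map $f:G\to H$ and an $L$-subset $\mu$ of $G$, the image $f(\mu)$ is the $L$-subset of $H$ given by $f(\mu)(y)=\bigvee_{x\in f^{-1}(y)}\mu(x)$, with the supremum of the empty set equal to $0$. The image of an $L$-subgroup under a group homomorphism is an $L$-subgroup. *)

(* Defs.v *)
From mathcomp Require Import all_boot all_order.
From mathcomp Require Import boolp classical_sets.

Set Implicit Arguments.
Unset Strict Implicit.
Unset Printing Implicit Defensive.

Import Order.TTheory.

Local Open Scope classical_set_scope.
Local Open Scope order_scope.
Local Open Scope group_scope.

Section CompleteLattice.
Context {d : Order.disp_t} {L : tbLatticeType d}.

(* The defaults of the library's [supremum] and [infimum], which are also their
   values on the empty set, are \bot and \top: these are the true bounds of set0,
   and the defaults are not used on other sets when L is complete. *)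
Definition bigsup (A : set L) : L := supremum \bot A.
Definition biginf (A : set L) : L := infimum \top A.

End CompleteLattice.

Definition complete_lattice {d : Order.disp_t} (L : tbLatticeType d) : Prop :=
  forall A : set L, supremums A !=set0 /\ infimums A !=set0.

(* For every family (J i) of subsets of L,
   inf_i (sup (J i)) = sup_phi (inf_i (phi i)), where phi ranges over the choice
   functions of the family. *)
Definition completely_distributive {d : Order.disp_t} (L : tbLatticeType d)
    : Prop :=
  complete_lattice L /\
  forall (I : Type) (J : I -> set L),
    biginf (range (fun i => bigsup (J i))) =
    bigsup [set biginf (range phi) | phi in [set phi | forall i, J i (phi i)]].

Section LSubsets.
Context {d : Order.disp_t} {L : tbLatticeType d}.

Definition Lsubset_le {X : Type} (eta mu : X -> L) : Prop :=
  forall x, eta x <= mu x.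

Definition Limage {X Y : Type} (f : X -> Y) (mu : X -> L) : Y -> L :=
  fun y => bigsup (mu @` (f @^-1` [set y])).

(* The L-point a_z is kept as the pair of a and z, because the L-subset a_z does
   not determine z when a = \bot. *)
Record Lpoint (X : eqType) := MkLpoint { Lheight : L; Lbase : X }.

Definition Lsubset_of_Lpoint {X : eqType} (p : Lpoint X) : X -> L :=
  fun x => if x == Lbase p then Lheight p else \bot.

Definition Lpoint_in {X : eqType} (p : Lpoint X) (mu : X -> L) : Prop :=
  Lheight p <= mu (Lbase p).

End LSubsets.

Coercion Lsubset_of_Lpoint : Lpoint >-> Funclass.

Section LSubgroups.
Context {d : Order.disp_t} {L : tbLatticeType d} {G : groupType}.

Definition Lsubgroup (mu : G -> L) : Prop :=
  (forall x y, Order.meet (mu x) (mu y) <= mu (x * y)) /\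
  (forall x, mu x^-1 = mu x).

Definition Lsubgroup_of (mu eta : G -> L) : Prop :=
  Lsubgroup eta /\ Lsubset_le eta mu.

Definition Lconj (eta : G -> L) (p : Lpoint G) : G -> L :=
  fun x => Order.meet (Lheight p) (eta (Lbase p * x * (Lbase p)^-1)).

Definition conjugate_Lsubgroup (mu eta zeta : G -> L) : Prop :=
  [/\ Lsubgroup mu, Lsubgroup_of mu eta, Lsubgroup_of mu zeta &
      exists p : Lpoint G, Lpoint_in p mu /\ zeta = Lconj eta p].

End LSubgroups.

(* Main.v *)
(** Complete distributivity, applied to the two families [{a}] and [A], yields
    the frame law: meets distribute over arbitrary suprema.  The frame law makes
    images of L-subgroups L-subgroups.  It also pulls the height [a] out of the
    supremum defining the image of the conjugate at [y]; what remains is the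
    supremum of the values of [eta] at [z x z^-1] with [f x = y], and conjugation
    by [z] is a bijection from the fibre of [f] over [y] to the fibre over
    [f z * y * (f z)^-1]. *)
Require Import Defs.
From mathcomp Require Import all_boot all_order.
From mathcomp Require Import boolp classical_sets.

Set Implicit Arguments.
Unset Strict Implicit.
Unset Printing Implicit Defensive.

Import Order.TTheory.

Local Open Scope classical_set_scope.
Local Open Scope order_scope.
Local Open Scope group_scope.

Lemma gmulf1_group (G H : groupType) (f : {multiplicative G -> H}) : f 1 = 1.
Proof. by apply: (mulgI (f 1)); rewrite -gmulfM !mulg1. Qed.

Lemma gmulfV_group (G H : groupType) (f : {multiplicative G -> H}) x :
  f x^-1 = (f x)^-1.
Proof.
by apply: (mulgI (f x)); rewrite -gmulfM !mulgV gmulf1_group.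
Qed.

Section CompleteLatticeTheory.
Context {d : Order.disp_t} {L : tbLatticeType d}.
Hypothesis HL : complete_lattice L.
Implicit Types (A : set L) (x : L).

Lemma supremums_bigsup A : supremums A (bigsup A).
Proof.
rewrite /bigsup /supremum; case: eqVneq => [->|_].
  by split=> // x _; exact: le0x.
by have [[s As] _] := HL A; case: xgetP => [y _|/(_ s)].
Qed.

Lemma infimums_biginf A : infimums A (biginf A).
Proof.
rewrite /biginf /infimum; case: eqVneq => [->|_].
  by split=> // x _; exact: lex1.
by have [_ [s As]] := HL A; case: xgetP => [y _|/(_ s)].
Qed.

Lemma bigsup_ub A x : A x -> x <= bigsup A.
Proof. by have [ub _] := supremums_bigsup A; exact: ub. Qed.

Lemma bigsup_le A x : ubound A x -> bigsup A <= x.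
Proof. by have [_ lb] := supremums_bigsup A; exact: lb. Qed.

Lemma le_bigsup A B : A `<=` B -> bigsup A <= bigsup B.
Proof. by move=> AB; apply: bigsup_le => x /AB; apply: bigsup_ub. Qed.

Lemma biginf_lb A x : A x -> biginf A <= x.
Proof. by have [lb _] := infimums_biginf A; exact: lb. Qed.

Lemma biginf_ge A x : lbound A x -> x <= biginf A.
Proof. by have [_ ub] := infimums_biginf A; exact: ub. Qed.

(** Over the index type [bool] the infima in the distributive law become binary meets, the form in
    which the law is applied below. *)
Lemma biginf_bool (phi : bool -> L) :
  biginf (range phi) = Order.meet (phi true) (phi false).
Proof.
apply/le_anti/andP; split.
  by rewrite lexI; apply/andP; split; apply: biginf_lb; [exists true|exists false].
by apply: biginf_ge => _ [[] _ <-]; [exact: leIl|exact: leIr].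
Qed.

End CompleteLatticeTheory.

Lemma meet_bigsup {d : Order.disp_t} {L : tbLatticeType d}
    (HL : completely_distributive L) (a : L) (A : set L) :
  Order.meet a (bigsup A) = bigsup (Order.meet a @` A).
Proof.
have [cL distrL] := HL; apply/le_anti/andP; split; last first.
  by apply: (bigsup_le cL) => _ [x Ax <-]; rewrite leI2 ?(bigsup_ub cL).
pose J b := if b then [set a] else A.
have := distrL bool J.
rewrite (biginf_bool cL) /= {1}/bigsup supremum1 => ->.
apply: (le_bigsup cL) => _ [phi Jphi <-].
(* A choice function must take the value [a] at [true], so only [phi false], an element of [A],
   varies. *)
rewrite (biginf_bool cL) (Jphi true : phi true = a).
by exists (phi false) => //; exact: (Jphi false).
Qed.

Section LimageTheory.
Context {d : Order.disp_t} {L : tbLatticeType d}.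
Hypothesis HL : completely_distributive L.

Let cL : complete_lattice L := HL.1.

Lemma Limage_ub (X Y : Type) (f : X -> Y) (mu : X -> L) x :
  mu x <= Limage f mu (f x).
Proof. by apply: (bigsup_ub cL); exists x. Qed.

Lemma Limage_le (X Y : Type) (f : X -> Y) (mu : X -> L) y a :
  (forall x, f x = y -> mu x <= a) -> Limage f mu y <= a.
Proof. by move=> mu_a; apply: (bigsup_le cL) => _ [x fxy <-]; exact: mu_a. Qed.

Lemma Limage_subset (X Y : Type) (f : X -> Y) (eta mu : X -> L) :
  Lsubset_le eta mu -> Lsubset_le (Limage f eta) (Limage f mu).
Proof.
move=> eta_mu y; apply: Limage_le => x <-.
exact: le_trans (eta_mu x) (Limage_ub f mu x).
Qed.

Lemma meet_Limage (X Y : Type) (f : X -> Y) (mu : X -> L) a y :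
  Order.meet a (Limage f mu y) = Limage f (fun x => Order.meet a (mu x)) y.
Proof. by rewrite /Limage (meet_bigsup HL) image_comp. Qed.

Lemma Limage_Lsubgroup (G H : groupType) (f : {multiplicative G -> H})
    (mu : G -> L) :
  Lsubgroup mu -> Lsubgroup (Limage f mu).
Proof.
move=> [muM muV]; split=> [u v|].
  (* The frame law, used once per factor, reduces the claim to single elements [y] over [v] and [x]
     over [u]. *)
  rewrite meet_Limage; apply: Limage_le => y <-.
  rewrite meetC meet_Limage; apply: Limage_le => x <-.
  by rewrite meetC -gmulfM; apply: le_trans (muM _ _) (Limage_ub f mu _).
have le_inv u : Limage f mu u^-1 <= Limage f mu u.
  apply: Limage_le => x fx.
  by rewrite -muV -[u]invgK -fx -gmulfV_group Limage_ub.
(* Inversion is an involution, so [le_inv] at [u^-1] gives the reverse inequality. *)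
by move=> u; apply/le_anti; rewrite le_inv -{1}[u]invgK le_inv.
Qed.

Lemma Limage_Lconj (G H : groupType) (f : {multiplicative G -> H})
    (eta : G -> L) (a : L) (z : G) :
  Limage f (Lconj eta (MkLpoint a z)) = Lconj (Limage f eta) (MkLpoint a (f z)).
Proof.
apply/funext => y; rewrite /Lconj /= -meet_Limage; congr (Order.meet a _).
apply/le_anti/andP; split; apply: Limage_le => x fx.
  by rewrite -fx -gmulfV_group -!gmulfM Limage_ub.
(* Here [x] lies over [f z * y * (f z)^-1]; its preimage under conjugation by [z] is [z^-1 * x * z],
   which lies over [y]. *)
have -> : y = f (z^-1 * x * z).
  by rewrite !gmulfM fx gmulfV_group !mulgA mulVg mul1g mulgVK.
have {1}-> : x = z * (z^-1 * x * z) * z^-1 by rewrite !mulgA mulgV mul1g mulgK.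
exact: (Limage_ub f (fun x => eta (z * x * z^-1))).
Qed.

End LimageTheory.

Section LconjTheory.
Context {d : Order.disp_t} {L : tbLatticeType d} {G : groupType}.
Implicit Types (mu eta : G -> L) (p : @Lpoint d L G).

(** Conjugation by the base point respects products and inverses, and the height is absorbed because
    meet is idempotent. *)
Lemma Lconj_Lsubgroup eta p : Lsubgroup eta -> Lsubgroup (Lconj eta p).
Proof.
case: p => a z [etaM etaV]; rewrite /Lconj /=; split=> [x y|x]; last first.
  by rewrite -etaV !invgM !invgK mulgA.
rewrite meetACA meetxx leI2 //.
apply: le_trans (etaM _ _) _.
by rewrite !mulgA mulgVK.
Qed.

(** With [z] the base point and [a] the height, [x] is the product of [z^-1], [z * x * z^-1] and
    [z]. On each factor [mu] is at least the value of the conjugate at [x], since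
    [a <= mu z = mu z^-1]. *)
Lemma Lconj_subset mu eta p :
  Lsubgroup mu -> Lsubset_le eta mu -> Lpoint_in p mu ->
  Lsubset_le (Lconj eta p) mu.
Proof.
case: p => a z [muM muV] eta_mu; rewrite /Lpoint_in /Lconj /= => az x /=.
have le_left : Order.meet a (eta (z * x * z^-1)) <= mu (x * z^-1).
  apply: (@le_trans _ _ (Order.meet (mu z^-1) (mu (z * x * z^-1)))).
    by rewrite muV leI2.
  by apply: le_trans (muM _ _) _; rewrite !mulgA mulVg mul1g.
apply: (@le_trans _ _ (Order.meet (mu (x * z^-1)) (mu z))).
  by rewrite lexI le_left (le_trans (leIl _ _)).
by apply: le_trans (muM _ _) _; rewrite mulgVK.
Qed.

End LconjTheory.

Theorem theorem3p4 (d : Order.disp_t) (L : tbLatticeType d)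
    (HL : completely_distributive L) (G H : groupType)
    (f : {multiplicative G -> H}) (mu : G -> L) (Hmu : Lsubgroup mu)
    (eta : G -> L) (Heta : Lsubgroup_of mu eta)
    (a : L) (z : G) (Haz : Lpoint_in (MkLpoint a z) mu) :
  conjugate_Lsubgroup (Limage f mu) (Limage f eta)
    (Limage f (Lconj eta (MkLpoint a z))) /\
  Lpoint_in (MkLpoint a (f z)) (Limage f mu) /\
  Limage f (Lconj eta (MkLpoint a z)) =
    Lconj (Limage f eta) (MkLpoint a (f z)).
Proof.
have [eta_sub eta_mu] := Heta.
have afz : Lpoint_in (MkLpoint a (f z)) (Limage f mu).
  exact: le_trans Haz (Limage_ub HL f mu z).
have imE := Limage_Lconj HL f eta a z.
split=> //; split.
- exact: Limage_Lsubgroup.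
- by split; [exact: Limage_Lsubgroup|exact: Limage_subset].
(* The conjugate is an L-subgroup of [mu] already in [G]; both properties then pass to images under
   [f]. *)
- split; first by apply: Limage_Lsubgroup => //; exact: Lconj_Lsubgroup.
  by apply: Limage_subset => //; exact: Lconj_subset.
- by exists (MkLpoint a (f z)).
Qed.
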